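(* Define integers $A'(n)$, $n\ge1$, by \[ \sum_{n=1}^\infty A'(n) q^n := \sum_{n=1}^\infty q^{n}(q^{n+1};q)_\infty^3 (q^{n};q)_{n}. \] Then \[ \sum_{n=1}^\infty q^{n}(q^{n+1};q)_\infty^3 (q^{n};q)_{n} = \sum_{n=1}^\infty (-1)^{n+1} n\, q^{\frac{n(n+1)}{2}}. \]
   Context: Here $q$ is a complex number with $|q|<1$ (equivalently, identities of formal power series in $q$). Notation: $(a;q)_0=1$, $(a;q)_n=\prod_{j=0}^{n-1}(1-aq^j)$, $(a;q)_\infty=\prod_{j=0}^{\infty}(1-aq^j)$, and $(a;q)_\infty^k$ denotes the $k$-th power of $(a;q)_\infty$. *)

(* Defs.v *)
From HB Require Import structures.
From mathcomp Require Import all_boot all_order all_algebra.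
From mathcomp Require Import complex.
From mathcomp Require Import all_classical all_reals all_analysis.

Set Implicit Arguments.
Unset Strict Implicit.
Unset Printing Implicit Defensive.

Import Order.TTheory GRing.Theory Num.Theory.
Import numFieldNormedType.Exports.

Local Open Scope classical_set_scope.
Local Open Scope complex_scope.
Local Open Scope ring_scope.

(* The bare type R[i] has no topology of its own; seen as a numFieldType
   it gets the one induced by the modulus. *)
Definition Cplx (R : realType) : numFieldType := R[i].

Definition qpoch (R : realType) (a q : Cplx R) (n : nat) : Cplx R :=
  \prod_(0 <= j < n) (1 - a * q ^+ j).

(* [limn] is total; the products do converge when `|q| < 1, the only case in
   which this is used. *)
Definition qpoch_inf (R : realType) (a q : Cplx R) : Cplx R :=
  limn (qpoch a q).

Definition sums_from_1 (R : realType) (f : nat -> Cplx R) (s : Cplx R) : Prop :=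
  (fun N : nat => \sum_(1 <= n < N) f n) @ \oo --> s.

Definition Aterm (R : realType) (q : Cplx R) (n : nat) : Cplx R :=
  q ^+ n * qpoch_inf (q ^+ n.+1) q ^+ 3 * qpoch (q ^+ n) q n.

(* The coefficients are those of the expansion in powers of q, valid on the
   whole open unit disc; the value A 0 is irrelevant. *)
Definition A_coefficients (R : realType) (A : nat -> int) : Prop :=
  forall q : Cplx R, `|q| < 1 ->
    exists s : Cplx R,
      sums_from_1 (Aterm q) s /\
      sums_from_1 (fun n => (A n)%:~R * q ^+ n) s.

(* Main.v *)
Require Import Defs.
From HB Require Import structures.
From mathcomp Require Import all_boot all_order all_algebra.
From mathcomp Require Import complex.
From mathcomp Require Import all_classical all_reals all_analysis.
From mathcomp Require Import ring lra zify.

Set Implicit Arguments.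
Unset Strict Implicit.
Unset Printing Implicit Defensive.

Import Order.TTheory GRing.Theory Num.Theory.
Import numFieldNormedType.Exports.

Local Open Scope classical_set_scope.
Local Open Scope ring_scope.

(* Write P_n = (q;q)_n and L = (q;q)_oo. Since (q^(n+1);q)_oo = L / P_n and
   (q^n;q)_n = P_2n / ((1 + q^n) P_n), the n-th term of the left-hand side is
   L^3 q^n P_2n / ((1 + q^n) P_n^4). Its partial sums have a closed form
   (a terminating Watson-Whipple transformation combined with the finite form
   of Jacobi's identity for L^3):
     sum_(1 <= n <= N) q^n P_2n / ((1 + q^n) P_n^4)
       = sum_(1 <= n <= N) (-1)^(n+1) n q^(n(n+1)/2)
                           P_(2N+1) / (P_N^2 P_(N-n) P_(N+n+1)).
   This is proved by induction on N, the increment of the right-hand side being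
   a telescoping sum. After multiplication by L^3 the ratio of P's on the right
   is 1 + O(|q|^(N-n)), so letting N tend to infinity gives the theorem.
   The coefficients A'(n) are read off the right-hand side; they are unique
   because a power series vanishing on the disc has zero coefficients. *)

(** * Triangular numbers and the finite products (q;q)_n *)

Definition triangular (n : nat) : nat := (n * n.+1)./2.

Lemma triangularS n : triangular n.+1 = (triangular n + n.+1)%N.
Proof.
rewrite /triangular (_ : (n.+1 * n.+2)%N = (n * n.+1 + n.+1.*2)%N); last by lia.
by rewrite halfD odd_double andbF add0n doubleK.
Qed.

(** This is (q;q)_n, stated over a general ring because it serves both for q itself and for the real
    number |q|. *)
Definition qfact (F : pzRingType) (q : F) (n : nat) : F :=
  \prod_(0 <= j < n) (1 - q ^+ j.+1).

Lemma qfactS (F : pzRingType) (q : F) n :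
  qfact q n.+1 = qfact q n * (1 - q ^+ n.+1).
Proof. by rewrite /qfact big_nat_recr. Qed.

(** * The finite identity, over a field in which no 1 - q^n with n >= 1 vanishes *)

Section FiniteIdentity.
Variables (F : fieldType) (q : F).
Hypothesis qn1 : forall n, 1 - q ^+ n.+1 != 0.

Lemma qfact_neq0 n : qfact q n != 0.
Proof. by elim: n => [|n IH]; rewrite ?qfactS ?mulf_neq0// /qfact big_nil oner_neq0. Qed.

(** It is a factor of 1 - q^(2n+2). *)
Lemma onepX_neq0 n : 1 + q ^+ n.+1 != 0.
Proof.
have := qn1 (n + n.+1); rewrite -addSn exprD.
rewrite (_ : 1 - _ = (1 - q ^+ n.+1) * (1 + q ^+ n.+1)); last by ring.
by rewrite mulf_eq0 negb_or => /andP[].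
Qed.

Definition weight N n : F :=
  qfact q N.*2.+1 / (qfact q N ^+ 2 * (qfact q (N - n) * qfact q (N + n).+1)).

(* Here k = n - 1. Without the factor n of [signed_tri n] the increments of the
   weights telescope; summation by parts then leaves the terms
   (-1)^n q^(n(n-1)/2) (1 + q^n) P_2N / (P_(N-n) P_(N+n)), which telescope too.
   The two steps give the two summands of the last factor. *)
Definition certificate N k : F :=
  (-1) ^+ k * q ^+ triangular k
  * (qfact q N.*2 / (qfact q N ^+ 2 * (qfact q (N - k.+1) * qfact q (N + k.+1))))
  * (q ^+ N / (1 + q ^+ N))
  * (k%:R * (1 + q ^+ k.+1) + (1 - q ^+ N * q ^+ k.+1) / (1 - q ^+ N)).

Definition signed_tri n : F := (-1) ^+ n.+1 * n%:R * q ^+ triangular n.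

(** With m = N - k - 1 all factorials reduce to P_N, P_(2N+1), P_m and P_(N+k+2), and all powers of
    q to q, q^k and q^m. What remains is an identity of rational functions in these quantities,
    which [field] checks. *)
Lemma weight_increment N k : (k < N)%N ->
  signed_tri k.+1 * (weight N.+1 k.+1 - weight N k.+1) =
  certificate N.+1 k - certificate N.+1 k.+1.
Proof.
move=> kN; have [m Nm] : exists m, N = (m + k.+1)%N by exists (N - k.+1)%N; lia.
rewrite /signed_tri /weight /certificate doubleS 2!subSS.
have -> : (N - k.+1 = m)%N by lia.
have -> : (N - k = m.+1)%N by lia.
have -> : (N.+1 + k.+1 = (N + k.+1).+1)%N by lia.
have -> : (N.+1 + k.+2 = (N + k.+1).+2)%N by lia.
rewrite triangularS exprD (qfactS q N.*2.+2) (qfactS q N.*2.+1).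
rewrite (qfactS q N) (qfactS q m) (qfactS q (N + k.+1).+1) (exprS q k.+1).
have xE : q ^+ N.+1 = q ^+ k.+1 * q ^+ m.+1 by rewrite -exprD; congr (_ ^+ _); lia.
have e1 : q ^+ (N.*2.+1).+1 = (q ^+ k.+1 * q ^+ m.+1) ^+ 2.
  by rewrite -xE -exprM; congr (_ ^+ _); lia.
have e2 : q ^+ (N.*2.+2).+1 = q * (q ^+ k.+1 * q ^+ m.+1) ^+ 2.
  by rewrite -xE -exprM -exprS; congr (_ ^+ _); lia.
have e3 : q ^+ (N + k.+1).+2 = q * (q ^+ k.+1 * q ^+ m.+1) * q ^+ k.+1.
  by rewrite -xE -exprS -exprD; congr (_ ^+ _); lia.
have := (qn1 N, qn1 N.*2.+1, qn1 m, qn1 (N + k.+1).+1, onepX_neq0 N).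
have := (qfact_neq0 N, qfact_neq0 m, qfact_neq0 (N + k.+1).+1).
rewrite e1 e2 e3 xE -!natr1 !exprS.
move: (q ^+ k) (q ^+ m) => x y.
move: (qfact _ _) (qfact _ _) (qfact _ _) (qfact _ _) => A B C D.
move: (_ ^+ triangular k) ((-1) ^+ k) k%:R => T s a.
move=> [] [] hA hC hD [] [] [] [] h1 h2 h3 h4 h5.
by field; rewrite h1 h5 h4 hD hC hA h3.
Qed.

(** The top term is treated apart: truncated subtraction gives [weight N N.+1] the factor 1/P_0, not
    the value 0 that 1/P_(-1) should have. *)
Lemma weight_last N : signed_tri N.+1 * weight N.+1 N.+1 = certificate N.+1 N.
Proof.
rewrite /signed_tri /weight /certificate subnn addnn (qfactS q N.+1.*2) triangularS exprD.
have := (qn1 N, qn1 N.+1.*2, onepX_neq0 N).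
have := (qfact_neq0 N.+1, qfact_neq0 N.+1.*2, qfact_neq0 0).
rewrite -!natr1 2!(exprS (-1)).
move: (q ^+ N.+1) => x; move: (q ^+ N.+1.*2.+1) => y.
move: (qfact _ _) (qfact _ _) (qfact _ _) => A B C.
move: (_ ^+ triangular N) ((-1) ^+ N) N%:R => T s a.
move=> [] [] hA hB hC [] [] h1 h2 h3.
by field; rewrite h1 h2 h3 hA hB hC.
Qed.

(** At k = 0 the last factor of [certificate] is (1 - q^(N+2)) / (1 - q^(N+1)), which turns P_N
    P_(N+2) in the denominator into P_(N+1)^2. The result is the new term on the left-hand side of
    the finite identity. *)
Lemma certificate0 N : certificate N.+1 0 =
  q ^+ N.+1 * qfact q N.+1.*2 / ((1 + q ^+ N.+1) * qfact q N.+1 ^+ 4).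
Proof.
rewrite /certificate subSS subn0 addn1 (qfactS q N.+1) (exprS q N.+1) (qfactS q N).
have := (qn1 N, qn1 N.+1, onepX_neq0 N).
have := (qfact_neq0 N).
rewrite !expr0 (exprS q N.+1).
move: (q ^+ N.+1) => x; move: (qfact _ _) (qfact _ _) => A B.
move=> hA [] [] h1 h2 h3.
by field; rewrite h1 h2 h3 hA.
Qed.

Lemma finite_identity N :
  \sum_(1 <= n < N.+1)
     q ^+ n * qfact q n.*2 / ((1 + q ^+ n) * qfact q n ^+ 4) =
  \sum_(1 <= n < N.+1) signed_tri n * weight N n.
Proof.
rewrite !big_add1 /=; elim: N => [|N IH]; first by rewrite !big_nil.
rewrite !big_nat_recr//= IH -certificate0 weight_last.
apply/eqP; rewrite -subr_eq -addrA addrC eq_sym -subr_eq -sumrB.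
(* The increments telescope to [certificate N.+1 0 - certificate N.+1 N], and the new top term
   cancels the second part. *)
rewrite -opprB -(telescope_sumr _ (leq0n N)) -sumrN; apply/eqP.
rewrite big_nat [RHS]big_nat; apply: eq_bigr => k /= kN.
by rewrite -mulrBr weight_increment// opprB.
Qed.
End FiniteIdentity.

(** * The modulus as a real number, and convergence of complex sequences *)

Section Modulus.
Variable R : realType.
Implicit Types z w : Cplx R.

(** The norm of [R[i]] takes its values in [R[i]], whose order is only partial; [cmod] moves it to
    [R], where [lra] and the lemmas on real sequences apply. *)
Definition cmod z : R := complex.Re (`|z| : R[i]).

Lemma cmodE z : `|z| = real_complex R (cmod z).
Proof. by rewrite /cmod (normc_def (z : R[i])). Qed.

Lemma cmod_ge0 z : 0 <= cmod z.
Proof. by rewrite /cmod (normc_def (z : R[i])) sqrtr_ge0. Qed.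

Lemma cmodM z w : cmod (z * w) = cmod z * cmod w.
Proof. by apply: (@complexI R); rewrite rmorphM -!cmodE normrM. Qed.

Lemma cmod1 : cmod 1 = 1.
Proof. by apply: (@complexI R); rewrite rmorph1 -!cmodE normr1. Qed.

Lemma cmod0 : cmod 0 = 0.
Proof. by apply: (@complexI R); rewrite rmorph0 -!cmodE normr0. Qed.

Lemma cmodN z : cmod (- z) = cmod z.
Proof. by apply: (@complexI R); rewrite -!cmodE normrN. Qed.

Lemma cmodBC z w : cmod (z - w) = cmod (w - z).
Proof. by rewrite -cmodN opprB. Qed.

Lemma cmodV z : cmod z^-1 = (cmod z)^-1.
Proof. by apply: (@complexI R); rewrite fmorphV -!cmodE normfV. Qed.

Lemma cmodX z n : cmod (z ^+ n) = cmod z ^+ n.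
Proof. by apply: (@complexI R); rewrite rmorphXn -!cmodE normrX. Qed.

Lemma cmod_nat n : cmod n%:R = n%:R.
Proof. by apply: (@complexI R); rewrite rmorph_nat -!cmodE normr_nat. Qed.

Lemma cmodD z w : cmod (z + w) <= cmod z + cmod w.
Proof.
have := ler_normD z w; rewrite !cmodE -rmorphD lecE => /andP[_]; exact.
Qed.

Lemma cmodB z w : cmod (z - w) <= cmod z + cmod w.
Proof. by rewrite (le_trans (cmodD _ _))// cmodN. Qed.

Lemma cmodB_ge z w : cmod z - cmod w <= cmod (z - w).
Proof. by rewrite lerBlDr (le_trans _ (cmodD _ _))// subrK. Qed.

Lemma cmod_sum (f : nat -> Cplx R) m n :
  cmod (\sum_(m <= i < n) f i) <= \sum_(m <= i < n) cmod (f i).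
Proof.
apply: (big_ind2 (fun x y => cmod x <= y)) => //; first by rewrite cmod0.
by move=> x a y b xa yb; rewrite (le_trans (cmodD _ _)) ?lerD.
Qed.

Lemma cmod_gt0 z : z != 0 -> 0 < cmod z.
Proof.
move=> z0; rewrite lt_def cmod_ge0 andbT; apply: contra z0 => /eqP h.
by rewrite -normr_eq0 cmodE h.
Qed.

Lemma Re_le_cmod z : `|complex.Re (z : R[i])| <= cmod z.
Proof. by have := normc_ge_Re (z : R[i]); rewrite -/(`|z|) cmodE lecE => /andP[]. Qed.

Lemma Im_le_cmod z : `|complex.Im (z : R[i])| <= cmod z.
Proof.
rewrite /cmod (normc_def (z : R[i])) /= -sqrtr_sqr ler_wsqrtr// lerDr sqr_ge0//.
Qed.

Lemma cmod_le_ReIm z :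
  cmod z <= `|complex.Re (z : R[i])| + `|complex.Im (z : R[i])|.
Proof.
rewrite /cmod (normc_def (z : R[i])) /=.
rewrite -(ler_pXn2r (n := 2))// ?nnegrE ?sqrtr_ge0 ?addr_ge0//.
rewrite sqr_sqrtr ?addr_ge0 ?sqr_ge0// sqrrD !real_normK ?num_real//.
by rewrite lerD2r lerDl mulrn_wge0// mulr_ge0.
Qed.

Lemma cvg_cmodP (u : nat -> Cplx R) (l : Cplx R) :
  u @ \oo --> l <->
  forall e : R, 0 < e -> exists N, forall n, (N <= n)%N -> cmod (u n - l) < e.
Proof.
split=> [/cvgrPdist_lt ul e e0|ul].
  have e0' : 0 < real_complex R e by rewrite ltcE/= eqxx.
  have [N _ H] := ul _ e0'; exists N => n /H.
  by rewrite /= cmodE ltcE/= => /andP[_]; rewrite cmodBC.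
apply/cvgrPdist_lt => e; rewrite ltcE => /andP[/eqP /= e1 e0].
have [N H] := ul _ e0; exists N => // n /= /H.
by rewrite cmodE ltcE /= e1 eqxx cmodBC.
Qed.

(** Completeness enters only through monotone convergence, applied to the real and imaginary parts
    separately. *)
Lemma cvg_of_summable_increments (u : nat -> Cplx R) (a : nat -> R) (M : R) :
    (forall n, cmod (u n.+1 - u n) <= a n) ->
    (forall n, \sum_(0 <= k < n) a k <= M) ->
  exists l : Cplx R, u @ \oo --> l.
Proof.
move=> ua aM.
have a0 n : 0 <= a n by rewrite (le_trans _ (ua n))// cmod_ge0.
have sS n : series a n.+1 = series a n + a n by rewrite /series/= big_nat_recr.
have cva : cvgn (series a).
  apply: nondecreasing_is_cvgn.
    by apply/nondecreasing_seqP => n; rewrite sS lerDl.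
  by exists M => _ [n _ <-]; exact: aM.
have real_part (p : nat -> R) : (forall n, `|p n.+1 - p n| <= a n) -> cvgn p.
  move=> pa.
  (* Since |p_(n+1) - p_n| <= a_n, the sequence p + [series a] is nondecreasing, and it is bounded
     by p_0 + 2M; so p is a difference of two convergent sequences. *)
  have -> : p = (fun n => (p n + series a n) - series a n).
    by apply/funext => n; rewrite addrK.
  apply: is_cvgB => //; apply: nondecreasing_is_cvgn.
    apply/nondecreasing_seqP => n; rewrite sS.
    have := pa n; rewrite ler_norml; lra.
  exists (p 0 + M + M) => _ [n _ <-].
  suff : p n <= p 0 + series a n by have := aM n; rewrite /series/=; lra.
  elim: n => [|n IH]; first by rewrite /series/= big_nil addr0.
  rewrite sS; have := pa n; rewrite ler_norml; lra.
have cRe : cvgn (fun n => complex.Re (u n : R[i])).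
  apply: real_part => n; apply: le_trans (ua n).
  by apply: le_trans (Re_le_cmod _); case: (u n) (u n.+1) => ? ? [].
have cIm : cvgn (fun n => complex.Im (u n : R[i])).
  apply: real_part => n; apply: le_trans (ua n).
  by apply: le_trans (Im_le_cmod _); case: (u n) (u n.+1) => ? ? [].
move/cvg_ex : cRe => -[x /cvgrPdist_lt hx].
move/cvg_ex : cIm => -[y /cvgrPdist_lt hy].
exists (Complex x y : Cplx R); apply/cvg_cmodP => e e0.
have e2 : 0 < e / 2 by lra.
have [N1 _ H1] := hx _ e2; have [N2 _ H2] := hy _ e2.
exists (maxn N1 N2) => n; rewrite geq_max => /andP[/H1 /= h1 /H2 /= h2].
rewrite cmodBC (le_lt_trans (cmod_le_ReIm _))//.
rewrite (_ : e = e / 2 + e / 2); last by field.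
by case: (u n) h1 h2 => ? ? /=; exact: ltrD.
Qed.

(** The increments from n on add up to at most B r^n / (1 - r). The finite sums, which carry the
    extra factor 1 - r^k, are bounded first; the limit is then reached up to an arbitrary e. *)
Lemma geometric_increments (u : nat -> Cplx R) (l : Cplx R) (B r : R) :
    0 <= r < 1 -> u @ \oo --> l ->
    (forall n, cmod (u n.+1 - u n) <= B * r ^+ n) ->
  forall n, cmod (u n - l) <= B / (1 - r) * r ^+ n.
Proof.
move=> /andP[r0 r1] /cvg_cmodP ul uB n.
have B0 : 0 <= B by have := uB 0; rewrite expr0 mulr1; exact/le_trans/cmod_ge0.
have step k : cmod (u n - u (n + k)%N) <= B / (1 - r) * r ^+ n * (1 - r ^+ k).
  elim: k => [|k IH]; first by rewrite addn0 subrr cmod0 expr0 subrr mulr0.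
  rewrite -(subrKA (u (n + k)%N)) (le_trans (cmodD _ _))//.
  rewrite addnS [X in _ + X]cmodBC; have := uB (n + k)%N.
  have -> : B * r ^+ (n + k) = B / (1 - r) * r ^+ n * (r ^+ k - r ^+ k.+1).
    by rewrite exprD exprS; field; rewrite subr_eq0 gt_eqF.
  move: IH; rewrite !mulrBr; lra.
apply/ler_addgt0Pr => e e0; have [N H] := ul _ e0.
have := H (n + N)%N (leq_addl _ _) => /ltW h.
rewrite -(subrKA (u (n + N)%N)) (le_trans (cmodD _ _))// lerD//.
rewrite (le_trans (step N))// ler_piMr ?gerBl ?exprn_ge0//.
by rewrite mulr_ge0 ?exprn_ge0// divr_ge0// subr_ge0 ltW.
Qed.

End Modulus.

(** * Bounds and convergence of (q;q)_n for |q| < 1 *)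

(** A product of factors 1 - t_i with t_i in [0,1] is at least 1 minus the sum of the t_i. Past an
    index J where the geometric tail is at most 1/2, the product therefore keeps at least half of
    P_J. *)
Lemma qfact_real_ge (R : realType) (r : R) : 0 <= r < 1 ->
  exists2 M : R, 0 < M & forall n, M <= qfact r n.
Proof.
move=> /andP[r0 r1].
have f01 n : 0 < 1 - r ^+ n.+1 <= 1.
  by rewrite subr_gt0 gerBl exprn_ge0// exprn_ilt1.
have P0 n : 0 < qfact r n.
  elim: n => [|n IH]; first by rewrite /qfact big_nil ltr01.
  by rewrite qfactS mulr_gt0//; case/andP: (f01 n).
have Pmono n k : qfact r (n + k) <= qfact r n.
  elim: k => [|k IH]; first by rewrite addn0.
  rewrite addnS qfactS (le_trans _ IH)// ler_piMr ?(ltW (P0 _))//.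
  by case/andP: (f01 (n + k)%N).
have [J hJ] : exists J, r ^+ J / (1 - r) <= 1 / 2.
  have /cvgrPdist_le h : (fun n => r ^+ n) @ \oo --> (0 : R).
    by apply: cvg_expr; rewrite ger0_norm.
  have e0 : 0 < (1 - r) / 2 by lra.
  have [J _ H] := h _ e0; exists J; have := H J (leqnn J).
  rewrite /= sub0r normrN ger0_norm ?exprn_ge0// => hh.
  by rewrite ler_pdivrMr ?subr_gt0//; lra.
set c := r ^+ J / (1 - r) in hJ.
have c0 : 0 <= c by rewrite divr_ge0 ?exprn_ge0// subr_ge0 ltW.
(* Here c (1 - r^n) is the sum of r^(J+i) over i < n. *)
have low n : qfact r J * (1 - c * (1 - r ^+ n)) <= qfact r (J + n).
  elim: n => [|n IH]; first by rewrite addn0 expr0 subrr mulr0 subr0 mulr1.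
  rewrite addnS qfactS.
  have /andP[f0 f1] := f01 (J + n)%N.
  apply: le_trans (ler_wpM2r (ltW f0) IH); rewrite -[leRHS]mulrA ler_wpM2l ?(ltW (P0 _))//.
  have e1 : c * (r ^+ n - r ^+ n.+1) = r ^+ (J + n).
    by rewrite /c exprD exprS; field; rewrite subr_eq0 gt_eqF.
  have : 0 <= c * (1 - r ^+ n) * r ^+ (J + n).+1.
    by rewrite mulr_ge0 ?exprn_ge0// mulr_ge0// subr_ge0 exprn_ile1// ltW.
  have : r ^+ (J + n).+1 <= r ^+ (J + n).
    by rewrite exprS ler_piMl ?exprn_ge0// ltW.
  rewrite -e1; move: (r ^+ n) (r ^+ n.+1) (r ^+ (J + n).+1) => x y z.
  clearbody c => h1 h2. lra.
exists (qfact r J / 2); first by rewrite divr_gt0.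
move=> n; have [nJ|Jn] := leqP n J.
  by have := Pmono n (J - n)%N; rewrite subnKC//; have := P0 J; lra.
have := low (n - J)%N; rewrite subnKC 1?ltnW//; apply: le_trans.
rewrite ler_wpM2l ?(ltW (P0 _))//.
have : c * (1 - r ^+ (n - J)) <= c.
  by rewrite ler_piMr// gerBl exprn_ge0.
lra.
Qed.

Section Disc.
Variables (R : realType) (q : Cplx R).
Hypothesis q1 : `|q| < 1.
Let r : R := cmod q.

Lemma cmod_q_itv : 0 <= r < 1.
Proof. by rewrite cmod_ge0/=; move: q1; rewrite cmodE ltcE => /andP[]. Qed.

Lemma cmod_1X n : 1 - r ^+ n <= cmod (1 - q ^+ n) <= 1 + r ^+ n.
Proof.
by rewrite -cmodX -(cmod1 R) cmodB_ge cmodB.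
Qed.

Lemma onemX_neq0 n : 1 - q ^+ n.+1 != 0.
Proof.
have /andP[r0 r1] := cmod_q_itv; have /andP[h _] := cmod_1X n.+1.
apply/eqP => h0; move: h; rewrite h0 cmod0 subr_le0 leNgt.
by rewrite exprn_ilt1.
Qed.

(** Below, |1 - q^j| >= 1 - r^j reduces to the real case. Above, |1 - q^j| (1 - r^j) <= 1 - r^(2j)
    <= 1, so |P_n(q)| P_n(r) <= 1 and the inverse of the lower bound is an upper bound. *)
Lemma qfact_bounds : exists M B : R,
  [/\ 0 < M, 0 < B & forall n, M <= cmod (qfact q n) <= B].
Proof.
have [M M0 hM] := qfact_real_ge cmod_q_itv; have /andP[r0 r1] := cmod_q_itv.
exists M, M^-1; split => //; first by rewrite invr_gt0.
have lo n : qfact r n <= cmod (qfact q n).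
  elim: n => [|n IH]; first by rewrite /qfact !big_nil cmod1.
  rewrite !qfactS cmodM ler_pM//; first exact: le_trans (ltW M0) (hM n).
    by rewrite subr_ge0 exprn_ile1// ltW.
  by case/andP: (cmod_1X n.+1).
move=> n; rewrite (le_trans (hM n))//=.
suff h : cmod (qfact q n) * qfact r n <= 1.
  rewrite -[M^-1]mul1r ler_pdivlMr//; apply: le_trans h.
  by rewrite ler_wpM2l ?cmod_ge0.
elim: n => [|n IH]; first by rewrite /qfact !big_nil cmod1 mulr1.
rewrite !qfactS cmodM mulrACA mulr_ile1//.
- by rewrite mulr_ge0 ?cmod_ge0// (le_trans (ltW M0)).
- by rewrite mulr_ge0 ?cmod_ge0// subr_ge0 exprn_ile1// ltW.
have /andP[_ h] := cmod_1X n.+1.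
have h1 : 0 <= 1 - r ^+ n.+1 by rewrite subr_ge0 exprn_ile1// ltW.
apply: le_trans (ler_wpM2r h1 h) _.
by rewrite mulrC -subr_sqr expr1n gerBl sqr_ge0.
Qed.

(** The increment P_(n+1) - P_n is -P_n q^(n+1), which decays geometrically as P_n is bounded. *)
Lemma qfact_cvg : exists (L : Cplx R) (C : R),
  qfact q @ \oo --> L /\ forall n, cmod (qfact q n - L) <= C * r ^+ n.
Proof.
have [M [B [M0 B0 hMB]]] := qfact_bounds; have /andP[r0 r1] := cmod_q_itv.
have inc n : cmod (qfact q n.+1 - qfact q n) <= B * r ^+ n.
  rewrite qfactS mulrBr mulr1 addrAC subrr add0r cmodN cmodM cmodX exprS.
  case/andP: (hMB n) => _ h; rewrite ler_pM ?cmod_ge0 ?mulr_ge0 ?exprn_ge0//.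
  by rewrite ler_piMl ?exprn_ge0// ltW.
have [n|L hL] := cvg_of_summable_increments (M := B / (1 - r)) inc.
  rewrite -big_distrr/= ler_wpM2l ?(ltW B0)//.
  rewrite -[leRHS]mul1r ler_pdivlMr ?subr_gt0//.
  have -> : (\sum_(0 <= i < n) r ^+ i) * (1 - r) = 1 - r ^+ n.
    elim: n => [|n IH]; first by rewrite big_nil mul0r expr0 subrr.
    by rewrite big_nat_recr//= mulrDl IH exprS; ring.
  by rewrite gerBl exprn_ge0.
exists L, (B / (1 - r)); split => // n.
exact: geometric_increments cmod_q_itv hL inc n.
Qed.

Lemma qpoch_shift n m : qpoch (q ^+ n.+1) q m = qfact q (n + m) / qfact q n.
Proof.
have h := qfact_neq0 onemX_neq0 n.
elim: m => [|m IH]; first by rewrite addn0 divff// /qpoch big_nil.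
by rewrite addnS qfactS /qpoch big_nat_recr//= -/(qpoch _ _ _) IH -exprD addSn mulrAC.
Qed.

Lemma qpoch_inf_shift (L : Cplx R) n : qfact q @ \oo --> L ->
  qpoch_inf (q ^+ n.+1) q = L / qfact q n.
Proof.
move=> qL; apply: cvg_lim; first exact: norm_hausdorff.
rewrite (_ : qpoch _ _ = fun m => qfact q (m + n) * (qfact q n)^-1).
  by apply: cvgM; [rewrite cvg_shiftn|exact: cvg_cst].
by apply/funext => m; rewrite qpoch_shift addnC.
Qed.

Lemma Aterm_eq (L : Cplx R) n : (0 < n)%N -> qfact q @ \oo --> L ->
  Aterm q n =
  L ^+ 3 * (q ^+ n * qfact q n.*2 / ((1 + q ^+ n) * qfact q n ^+ 4)).
Proof.
case: n => // n _ qL; rewrite /Aterm (qpoch_inf_shift _ qL) qpoch_shift.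
have -> : (n + n.+1 = n.*2.+1)%N by lia.
rewrite doubleS (qfactS q n.*2.+1) (qfactS q n).
have -> : q ^+ n.*2.+2 = q ^+ n.+1 ^+ 2 by rewrite -exprM; congr (_ ^+ _); lia.
have := (onemX_neq0 n, onepX_neq0 onemX_neq0 n, qfact_neq0 onemX_neq0 n).
move: (q ^+ n.+1) (qfact q n) (qfact q n.*2.+1) => x A B [] [] h1 h2 h3.
by field; rewrite h1 h2 h3.
Qed.

(** The exponent rests on (n+1)(n+2)/2 >= 2n+1. The factor r^(n+1) is kept apart to be combined with
    the error r^(N-n-1) of the weight; the other factor is summable. *)
Lemma signed_tri_bound n :
  cmod (signed_tri q n.+1) <= r ^+ n.+1 * (n.+1%:R * r ^+ n).
Proof.
have /andP[r0 r1] := cmod_q_itv.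
rewrite /signed_tri 2!cmodM !cmodX cmodN cmod1 expr1n mul1r cmod_nat mulrCA.
rewrite ler_wpM2l// -exprD; apply: ler_wiXn2l => //; first exact: ltW.
by elim: n => // n IH; rewrite triangularS; lia.
Qed.

Lemma sum_arith_geom n :
  \sum_(0 <= k < n) k.+1%:R * r ^+ k <= (1 - r) ^- 2.
Proof.
have /andP[r0 r1] := cmod_q_itv.
have r1' : 0 < 1 - r by rewrite subr_gt0.
rewrite -[leRHS]mul1r ler_pdivlMr ?exprn_gt0//.
(* The finite form of sum (k+1) r^k = 1/(1-r)^2. *)
have -> : (\sum_(0 <= k < n) k.+1%:R * r ^+ k) * (1 - r) ^+ 2 =
    1 - r ^+ n * (1 + n%:R * (1 - r)).
  elim: n => [|n IH]; first by rewrite big_nil expr0; ring.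
  by rewrite big_nat_recr//= mulrDl IH -natr1 (exprS _ n); ring.
by rewrite gerBl mulr_ge0 ?exprn_ge0// addr_ge0// mulr_ge0// ltW.
Qed.

End Disc.

(** * Passage to the limit in the finite identity *)

Lemma cmod_mulB (R : realType) (B d : R) (x x' y y' : Cplx R) :
    cmod x <= B -> cmod y' <= B -> cmod (x - x') <= d -> cmod (y - y') <= d ->
  cmod (x * y - x' * y') <= 2 * B * d.
Proof.
move=> xB yB xd yd.
rewrite (_ : _ - _ = x * (y - y') + (x - x') * y'); last by ring.
rewrite (le_trans (cmodD _ _))// !cmodM.
have -> : 2 * B * d = B * d + d * B by ring.
by rewrite lerD// ler_pM// cmod_ge0.
Qed.

Lemma sums_from_1P (R : realType) (f : nat -> Cplx R) (s : Cplx R) :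
  sums_from_1 f s <->
  forall e : R, 0 < e -> exists N0, forall N, (N0 <= N)%N ->
    cmod (\sum_(0 <= k < N) f k.+1 - s) < e.
Proof.
rewrite /sums_from_1 cvg_cmodP; split=> H e /H[N0 {}H].
  by exists N0 => N N0N; have := H N.+1 (leqW N0N); rewrite big_add1.
exists N0.+1 => -[//|N] N0N; rewrite big_add1/=; exact: H.
Qed.

Lemma sums_from_1B (R : realType) (f g : nat -> Cplx R) (s t : Cplx R) :
  sums_from_1 f s -> sums_from_1 g t ->
  sums_from_1 (fun n => f n - g n) (s - t).
Proof.
rewrite !sums_from_1P => fs gt e e0; have e2 : 0 < e / 2 by lra.
have [N1 H1] := fs _ e2; have [N2 H2] := gt _ e2.
exists (maxn N1 N2) => N; rewrite geq_max => /andP[/H1 h1 /H2 h2].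
rewrite sumrB; move: (\sum_(0 <= k < N) f _) (\sum_(0 <= k < N) g _) h1 h2.
move=> F G h1 h2; rewrite (_ : _ - _ = (F - s) - (G - t)); last by ring.
by rewrite (le_lt_trans (cmodB _ _))//; lra.
Qed.

Section DiscSums.
Variables (R : realType) (q : Cplx R).
Hypothesis q1 : `|q| < 1.
Let r : R := cmod q.

(** The difference is (L L (L P_(2N+1)) - D) / D with D = P_N^2 P_(N-n) P_(N+n+1). The numerator is
    compared factor by factor: every index involved is at least N - n, so each P is within C r^(N-n)
    of L, while |D| is bounded below. *)
Lemma weight_approx : exists (L : Cplx R) (C : R),
  qfact q @ \oo --> L /\ forall N n, (n <= N)%N ->
    cmod (L ^+ 3 * weight q N n - 1) <= C * r ^+ (N - n).
Proof.
have /andP[r0 r1] := cmod_q_itv q1.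
have [L [C [qL LC]]] := qfact_cvg q1.
have [M [B [M0 B0 MB]]] := qfact_bounds q1.
have C0 : 0 <= C by have := LC 0; rewrite expr0 mulr1; exact/le_trans/cmod_ge0.
(* A common bound for all |P_n| and for |L|. *)
pose B' := B + C.
have PB n : cmod (qfact q n) <= B'.
  by case/andP: (MB n) => _ h; rewrite (le_trans h)// lerDl.
have LB : cmod L <= B'.
  rewrite -(subKr (qfact q 0) L) (le_trans (cmodB _ _))// lerD//.
    by case/andP: (MB 0).
  by have := LC 0; rewrite expr0 mulr1.
have B'0 : 0 <= B' by exact: le_trans (cmod_ge0 _) LB.
exists L, (2 * (B' * B') * (2 * B' * (2 * C)) / M ^+ 4); split=> // N n nN.
have i1 : (N - n <= N)%N by exact: leq_subr.
have i2 : (N - n <= N.*2.+1)%N by rewrite -addnn; lia.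
have i3 : (N - n <= (N + n).+1)%N by lia.
(* The factor 2 is for the pair P_(2N+1), P_(N+n+1), compared through L. *)
set d := 2 * C * r ^+ (N - n).
have r_le m : (N - n <= m)%N -> C * r ^+ m <= C * r ^+ (N - n).
  by move=> h; rewrite ler_wpM2l// ler_wiXn2l// ltW.
have Lm m : (N - n <= m)%N -> cmod (L - qfact q m) <= d.
  move=> /r_le h; rewrite cmodBC (le_trans (LC m))// (le_trans h)//.
  by rewrite /d -mulrA mulr_natl mulr2n lerDl mulr_ge0// exprn_ge0.
have Pd : cmod (qfact q N.*2.+1 - qfact q (N + n).+1) <= d.
  rewrite -(subrKA L) (le_trans (cmodD _ _))//.
  have -> : d = C * r ^+ (N - n) + C * r ^+ (N - n) by rewrite /d; ring.
  rewrite lerD//; last rewrite cmodBC.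
    by rewrite (le_trans (LC _))// r_le.
  by rewrite (le_trans (LC _))// r_le.
set D := qfact q N ^+ 2 * (qfact q (N - n) * qfact q (N + n).+1).
have Pn0 := qfact_neq0 (onemX_neq0 q1).
have D0 : D != 0 by rewrite !mulf_neq0// expf_neq0.
have DM : M ^+ 4 <= cmod D.
  have MP m : M <= cmod (qfact q m) by case/andP: (MB m).
  have -> : M ^+ 4 = M * M * (M * M) by ring.
  by rewrite /D expr2 !cmodM !ler_pM// ?mulr_ge0// ltW.
rewrite /weight -/D.
have -> : L ^+ 3 * (qfact q N.*2.+1 / D) - 1 =
    ((L * L) * (L * qfact q N.*2.+1) - D) / D by field.
rewrite cmodM cmodV.
have -> : 2 * (B' * B') * (2 * B' * (2 * C)) / M ^+ 4 * r ^+ (N - n) =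
   2 * (B' * B') * (2 * B' * d) / M ^+ 4.
  by rewrite /d; field; rewrite gt_eqF.
apply: ler_pM; rewrite ?cmod_ge0// ?invr_ge0 ?cmod_ge0//; last first.
  by rewrite lef_pV2// posrE ?exprn_gt0// cmod_gt0.
rewrite /D expr2; apply: cmod_mulB.
- by rewrite cmodM ler_pM// cmod_ge0.
- by rewrite cmodM ler_pM// cmod_ge0.
- exact: cmod_mulB LB (PB _) (Lm _ i1) (Lm _ i1).
- exact: cmod_mulB LB (PB _) (Lm _ (leqnn _)) Pd.
Qed.

Lemma signed_tri_summable : exists s : Cplx R, sums_from_1 (signed_tri q) s.
Proof.
have /andP[r0 r1] := cmod_q_itv q1.
have inc n : cmod (\sum_(0 <= k < n.+1) signed_tri q k.+1 -
                   \sum_(0 <= k < n) signed_tri q k.+1) <= n.+1%:R * r ^+ n.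
  rewrite big_nat_recr//= addrAC subrr add0r (le_trans (signed_tri_bound q1 n))//.
  by rewrite ler_piMl ?mulr_ge0 ?exprn_ge0// exprn_ile1// ltW.
have [s /cvg_cmodP hs] := cvg_of_summable_increments inc (sum_arith_geom q1).
by exists s; apply/sums_from_1P.
Qed.

(** By the finite identity the two N-th partial sums differ by the sum of [signed_tri] times (L^3
    [weight] - 1), which is at most C r^N / (1 - r)^2 in modulus. *)
Lemma Aterm_sum (s : Cplx R) :
  sums_from_1 (signed_tri q) s -> sums_from_1 (Aterm q) s.
Proof.
have /andP[r0 r1] := cmod_q_itv q1.
have [L [C [qL LC]]] := weight_approx.
have C0 : 0 <= C.
  by have := LC 0 0 isT; rewrite expr0 mulr1; exact/le_trans/cmod_ge0.
move=> /sums_from_1P ws; apply/sums_from_1P => e e0.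
(* The summand 1 makes the constant positive even if C = 0, so that e/2 can be divided by it. *)
have K0 : 0 < C * (1 - r) ^- 2 + 1.
  by rewrite ltr_wpDl// mulr_ge0// invr_ge0 exprn_ge0// subr_ge0 ltW.
have e2 : 0 < e / 2 by lra.
have [N1 H1] := ws _ e2.
have /cvgrPdist_lt rN : (fun n => r ^+ n) @ \oo --> (0 : R).
  by apply: cvg_expr; rewrite ger0_norm.
have [N2 _ H2] := rN _ (divr_gt0 e2 K0).
exists (maxn N1 N2) => N; rewrite geq_max => /andP[/H1 h1 /H2 /=].
rewrite sub0r normrN ger0_norm ?exprn_ge0// ltr_pdivlMr// => h2.
rewrite -(subrKA (\sum_(0 <= k < N) signed_tri q k.+1)).
rewrite (le_lt_trans (cmodD _ _))//.
rewrite (_ : e = e / 2 + e / 2); last by field.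
apply: ltrD => //; apply: le_lt_trans h2.
rewrite (eq_bigr (fun k => L ^+ 3 * (q ^+ k.+1 * qfact q k.+1.*2 /
  ((1 + q ^+ k.+1) * qfact q k.+1 ^+ 4)))); last by move=> k _; rewrite (Aterm_eq q1 _ qL).
rewrite -big_distrr/=.
have := finite_identity (onemX_neq0 q1) N; rewrite !big_add1/= => ->.
rewrite big_distrr/= -sumrB.
rewrite (eq_bigr (fun k => signed_tri q k.+1 * (L ^+ 3 * weight q N k.+1 - 1))); last first.
  by move=> k _; rewrite mulrBr mulr1 mulrCA.
rewrite (le_trans (cmod_sum _ _ _))//.
apply: (@le_trans _ _ (\sum_(0 <= k < N) C * r ^+ N * (k.+1%:R * r ^+ k))).
  rewrite big_nat [leRHS]big_nat; apply: ler_sum => k /= kN.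
  (* Here r^(k+1) r^(N-k-1) = r^N comes out of the sum. *)
  have -> : C * r ^+ N * (k.+1%:R * r ^+ k) =
      r ^+ k.+1 * (k.+1%:R * r ^+ k) * (C * r ^+ (N - k.+1)).
    by rewrite -[in LHS](subnKC kN) exprD; ring.
  by rewrite cmodM ler_pM ?cmod_ge0// ?signed_tri_bound ?LC.
rewrite -big_distrr/=.
apply: le_trans (ler_wpM2l (mulr_ge0 C0 (exprn_ge0 N r0)) (sum_arith_geom q1 N)) _.
by rewrite mulrDr mulr1 mulrCA mulrA lerDl exprn_ge0.
Qed.

End DiscSums.

(** * The integer coefficients A'(n) of the right-hand side *)

(* [tri_index n] is the least [k >= 1] whose triangular number is at least [n]. *)
Fixpoint tri_index (n : nat) : nat :=
  if n is m.+1 then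
    if triangular (tri_index m) == m then (tri_index m).+1 else tri_index m
  else 1.

Lemma tri_index_ge n : (n <= triangular (tri_index n))%N.
Proof.
elim: n => // n IH /=; case: eqP => [e|/eqP ne].
  by rewrite triangularS e; lia.
by rewrite ltn_neqAle eq_sym ne.
Qed.

Lemma tri_index_gt0 n : (0 < tri_index n)%N.
Proof. by elim: n => // n IH /=; case: ifP. Qed.

Lemma leq_triangular m n : (m <= n)%N -> (triangular m <= triangular n)%N.
Proof. by move=> mn; apply: half_leq; rewrite leq_mul. Qed.

(** For n >= 1, n is triangular exactly when the triangular number of index [tri_index n] equals
    n. *)
Definition tri_coef (n : nat) : int :=
  if triangular (tri_index n) == n
  then (-1) ^+ (tri_index n).+1 * (tri_index n)%:R else 0.

(** For k >= 1 the k-th triangular number is below N exactly when k < [tri_index N], so both sides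
    have the same nonzero terms. *)
Lemma tri_coef_sum (F : fieldType) (q : F) N :
  \sum_(1 <= n < N) (tri_coef n)%:~R * q ^+ n =
  \sum_(1 <= k < tri_index N) signed_tri q k.
Proof.
elim: N => [|[|N] IH]; [by rewrite !big_geq|by rewrite !big_geq|].
rewrite big_nat_recr// IH [tri_index N.+2]/= -/(tri_index N.+1) /tri_coef.
case: eqP => [e|_]; last by rewrite mulr0z mul0r; exact: addr0.
rewrite [RHS]big_nat_recr ?tri_index_gt0//; congr (_ + _).
by rewrite /signed_tri e rmorphM rmorphXn rmorphN rmorph1 rmorph_nat.
Qed.

Lemma tri_coef_sums (R : realType) (q s : Cplx R) :
  sums_from_1 (signed_tri q) s ->
  sums_from_1 (fun n => (tri_coef n)%:~R * q ^+ n) s.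
Proof.
move=> /cvg_cmodP H; apply/cvg_cmodP => e /H[K {}H].
(* Past this rank [tri_index N >= K]: otherwise N would be at most the K-th triangular number. *)
exists (triangular K).+1 => N KN; rewrite tri_coef_sum; apply: H.
rewrite leqNgt; apply/negP => /ltnW /leq_triangular.
by apply/negP; rewrite -ltnNge (leq_trans KN) ?tri_index_ge.
Qed.

(** * Uniqueness of integer power series coefficients *)

Lemma geometric_tail (R : realType) (y : R) a c : 0 <= y <= 1 / 2 ->
  \sum_(a <= k < a + c) y ^+ k <= 2 * y ^+ a.
Proof.
move=> /andP[y0 y1].
suff : \sum_(a <= k < a + c) y ^+ k <= 2 * y ^+ a - 2 * y ^+ (a + c).
  by move/le_trans; apply; rewrite gerBl mulr_ge0 ?exprn_ge0.
elim: c => [|c IH]; first by rewrite addn0 big_geq// subrr.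
rewrite addnS big_nat_recr ?leq_addr//= exprS.
have := exprn_ge0 (a + c) y0; move: IH; move: (y ^+ (a + c)) => z; nra.
Qed.

Lemma cmod_int_ge1 (R : realType) (z : int) :
  z != 0 -> 1 <= cmod (z%:~R : Cplx R).
Proof.
move=> z0; have -> : cmod (z%:~R : Cplx R) = `|z|%:~R.
  by apply: (@complexI R); rewrite -cmodE rmorph_int -intr_norm.
by rewrite ler1z; move: z0; rewrite -normr_gt0.
Qed.

(** At a small point x = 1/m the first nonzero term has modulus at least x^(p+1), its coefficient
    being an integer, and it dominates the tail; the sum cannot then be 0. *)
Lemma power_series_eq0 (R : realType) (D : nat -> int) :
    (forall q : Cplx R, `|q| < 1 ->
      sums_from_1 (fun n => (D n)%:~R * q ^+ n) 0) ->
  forall n, D n.+1 = 0.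
Proof.
move=> D0.
have nat_disc m : (1 < m)%N -> `|m%:R^-1 : Cplx R| < 1.
  move=> m1; rewrite normfV normr_nat invf_lt1 ?ltr1n//.
  by rewrite ltr0n ltnW.
pose d k : R := cmod ((D k.+1)%:~R : Cplx R).
have d0 k : 0 <= d k by exact: cmod_ge0.
(* Growth bound from convergence at q = 1/2: from rank K on, a term is a difference of two partial
   sums of modulus below 1, hence at most 2. The sum over k < K covers the earlier coefficients. *)
have [C C0 dC] : exists2 C : R, 0 <= C & forall k, d k <= C * 2 ^+ k.+1.
  have [K HK] := (sums_from_1P _ _).1 (D0 _ (nat_disc 2 isT)) 1 ltr01.
  exists (2 + \sum_(0 <= k < K) d k) => [|k].
    by rewrite addr_ge0// sumr_ge0.
  have p1 : 1 <= 2 ^+ k.+1 :> R by rewrite exprn_ege1// ler1n.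
  have S0 : 0 <= \sum_(0 <= k < K) d k by rewrite sumr_ge0.
  have [kK|Kk] := ltnP k K.
    apply: (@le_trans _ _ (\sum_(0 <= k < K) d k)); last by nra.
    by rewrite (big_rem k) ?mem_index_iota//= lerDl sumr_ge0.
  have := HK k Kk; have := HK k.+1 (leqW Kk).
  rewrite big_nat_recr//= !subr0; set S := \sum_(0 <= i < k) _ => h1 h2.
  have : cmod ((D k.+1)%:~R * 2%:R^-1 ^+ k.+1 : Cplx R) <= 2.
    rewrite -(addrK S (_ * _)) [X in X - S]addrC (le_trans (cmodB _ _))//.
    lra.
  rewrite cmodM cmodX cmodV cmod_nat exprVn ler_pdivrMr ?exprn_gt0// -/(d k).
  by move/le_trans; apply; rewrite ler_wpM2r ?exprn_ge0// lerDl.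
elim/ltn_ind => p IH; apply/eqP/negPn/negP => Dp.
(* The size of m makes the tail at most x^(p+1)/2, and m >= 4 gives 2x <= 1/2, as [geometric_tail]
   requires. *)
pose m := (Num.trunc (8 * C * 2 ^+ p.+1)).+4.
pose x : R := m%:R^-1.
have x0 : 0 < x by rewrite invr_gt0 ltr0n.
have mx : m%:R * x = 1 by rewrite divff// pnatr_eq0.
have x4 : 2 * x <= 1 / 2.
  have : 4 * x <= m%:R * x by rewrite ler_wpM2r ?(ltW x0)// ler_nat.
  lra.
have xC : 8 * C * 2 ^+ p.+1 * x <= 1.
  rewrite -[leRHS]mx ler_wpM2r ?(ltW x0)//.
  apply: le_trans (ltW (truncnS_gt _)) _.
  by rewrite ler_nat; exact: (leq_addl 3).
have e0 : 0 < x ^+ p.+1 / 2 by rewrite divr_gt0 ?exprn_gt0.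
have [N HN] := (sums_from_1P _ _).1 (D0 _ (nat_disc m isT)) _ e0.
have := HN (p.+1 + N)%N (leq_addl _ _); rewrite subr0.
(* The partial sum splits into terms that vanish by induction, the term of degree p+1, and a tail
   T. *)
rewrite (big_cat_nat (n := p.+1)) ?leq_addr//= big_nat_recr//=.
rewrite big_nat big1 => [|i ip]; last by rewrite IH// mul0r.
rewrite add0r; set T := \sum_(p.+1 <= i < _) _.
have Tle : cmod T <= C * (2 * (2 * x) ^+ p.+2).
  rewrite (le_trans (cmod_sum _ _ _))//.
  apply: (@le_trans _ _ (\sum_(p.+1 <= i < p.+1 + N) C * (2 * x) * (2 * x) ^+ i)).
    apply: ler_sum => i _; rewrite cmodM cmodX cmodV cmod_nat -/x -/(d i).
    rewrite -mulrA -exprS exprMn mulrA ler_wpM2r ?exprn_ge0// ltW//.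
  rewrite -big_distrr/= [_ ^+ p.+2]exprS.
  have x01 : 0 <= 2 * x <= 1 / 2 by rewrite x4 mulr_ge0 ?(ltW x0).
  have h := geometric_tail p.+1 N x01.
  rewrite -mulrA ler_wpM2l// [leRHS]mulrCA ler_wpM2l ?mulr_ge0 ?(ltW x0)//.
apply/negP; rewrite -leNgt.
rewrite -[T]opprK (le_trans _ (cmodB_ge _ _))// cmodN.
rewrite cmodM cmodX cmodV cmod_nat -/x.
have h1 : x ^+ p.+1 <= cmod ((D p.+1)%:~R : Cplx R) * x ^+ p.+1.
  by rewrite ler_peMl ?exprn_ge0 ?(ltW x0)// cmod_int_ge1.
have h2 : C * (2 * (2 * x) ^+ p.+2) <= x ^+ p.+1 / 2.
  have -> : C * (2 * (2 * x) ^+ p.+2) =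
    (8 * C * 2 ^+ p.+1 * x) * (x ^+ p.+1 / 2).
    by rewrite exprMn !exprS; field.
  by rewrite ler_piMl// ltW.
lra.
Qed.

Theorem theorem1p2 (R : realType) :
  (exists A' : nat -> int,
     A_coefficients R A' /\
     forall B : nat -> int, A_coefficients R B ->
       forall n : nat, (1 <= n)%N -> B n = A' n) /\
  (forall q : Cplx R, `|q| < 1 ->
     exists s : Cplx R,
       sums_from_1
         (fun n => q ^+ n * qpoch_inf (q ^+ n.+1) q ^+ 3 * qpoch (q ^+ n) q n)
         s /\
       sums_from_1
         (fun n => (-1) ^+ n.+1 * n%:R * q ^+ (n * n.+1)./2) s).
Proof.
split; last first.
  move=> q q1; have [s ws] := signed_tri_summable q1.
  by exists s; split; [exact: Aterm_sum|].
have tri_coefP : A_coefficients R tri_coef.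
  move=> q q1; have [s ws] := signed_tri_summable q1.
  by exists s; split; [exact: Aterm_sum|exact: tri_coef_sums].
(* For uniqueness, both expansions have the same sum at each q of the disc, namely the limit of the
   partial sums of [Aterm q]; the power series of the difference is therefore 0. *)
exists tri_coef; split=> // B BP [//|n] _; apply/eqP; rewrite -subr_eq0; apply/eqP.
apply: (@power_series_eq0 R (fun n => B n - tri_coef n)) => q q1.
have [s [As Bs]] := BP q q1; have [s' [As' ts]] := tri_coefP q q1.
have ss' : s = s' by apply: cvg_unique As As'; exact: norm_hausdorff.
rewrite -{}ss' in ts.
have := sums_from_1B Bs ts; rewrite subrr.
congr sums_from_1; apply/funext => k.
by rewrite intrB mulrBl.
Qed.
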